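(* Let $S$ be a set of non-Archimedean places of $\mathbb{Q}$, $X$ the set of places of $\overline{\mathbb{Q}}$ dividing a place in $S$, and let $c:\mathcal J\to\mathbb{R}$ be a consistent map. Let $\mathcal F=\{f_\alpha:\alpha\in\overline{\mathbb{Q}}^\times\}$, where $f_\alpha:X\to\mathbb{R}$, $f_\alpha(x)=\log\|\alpha\|_x$. Then $\Phi_c(\mathcal F)\subseteq\mathbb{Q}$ if and only if $c(K,v)\log p_v\in\mathbb{Q}$ for all $(K,v)\in\mathcal J$.
   Context: Fix an algebraic closure $\overline{\mathbb{Q}}$; number fields lie inside it. For a place $v$ of a number field $K$, $p_v$ denotes the place of $\mathbb{Q}$ (here a prime) below $v$. $Y$ is the set of all places of $\overline{\mathbb{Q}}$, $Y(K,v)=\{y\in Y:y\mid v\}$, with topology having basis $\{Y(K,v)\}$. For $y\in Y$ dividing the prime $p$, $\|\cdot\|_y$ is the absolute value on $\overline{\mathbb{Q}}$ associated with $y$ extending the usual $p$-adic absolute value on $\mathbb{Q}$ (so $\|p\|_y=p^{-1}$); for $v$ a place of $K$, $\|\cdot\|_v$ is the corresponding absolute value on $K$ extending the $p_v$-adic one. $M_K(S)$ is the set of places of $K$ dividing a place of $S$, and $\mathcal J=\{(K,v): K \text{ a number field},\ v\in M_K(S)\}$. A map $c:\mathcal J\to\mathbb{R}$ is consistent if $c(K,v)=\sum_{w\mid v}c(L,w)$ for all $(K,v)\in\mathcal J$ and all finite extensions $L/K$. Each $f_\alpha$ is a locally constant, compactly supported function on $X$. For $f$ locally constant with compact support on $X$,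 there is a number field $K$ with $f$ constant on each $Y(K,v)$, $v\in M_K(S)$, with value $f(v)$ zero for all but finitely many $v$, and $\Phi_c(f)=\sum_{v\in M_K(S)}c(K,v)f(v)$, independent of such $K$. *)

(* Defs.v *)
(* Qbar := algC (MathComp's algebraic closure of Q). *)
From HB Require Import structures.
From mathcomp Require Import all_boot all_order all_algebra all_field.
From mathcomp Require Import all_classical all_reals.
From mathcomp Require Import exp.
Set Implicit Arguments. Unset Strict Implicit. Unset Printing Implicit Defensive.
Import Order.TTheory GRing.Theory Num.Theory.
Local Open Scope ring_scope.
Local Open Scope classical_set_scope.

Section Defs.
Variable R : realType.

Definition padic_abs (p : nat) (q : rat) : R :=
  if q == 0 then 0
  else (p%:R : R) ^ ((logn p `|denq q|%N)%:Z - (logn p `|numq q|%N)%:Z).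

(* an absolute value on Qbar = algC extending the p-adic absolute value of Q;
   such absolute values are exactly the ||.||_y for the places y of Qbar above p *)
Definition absval_over (p : nat) (y : algC -> R) : Prop :=
  [/\ (forall x, y x = 0 <-> x = 0),
      (forall x z, y (x * z) = y x * y z),
      (forall x z, y (x + z) <= y x + y z) &
      (forall q : rat, y (ratr q) = padic_abs p q)].

Definition number_field (K : set algC) : Prop :=
  [/\ K 1,
      (forall x z, K x -> K z -> K (x - z)),
      (forall x z, K x -> K z -> K (x * z)),
      (forall x, K x -> K x^-1) &
      exists s : seq algC, forall x, K x ->
        exists c : seq rat, x = \sum_(i < size s) ratr (nth 0 c i) * s`_i ].

Definition restr (K : set algC) (y : algC -> R) : algC -> R :=
  fun x => if `[< K x >] then y x else 0.

(* v is a place of K above p, represented by its absolute value ||.||_v on K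
   (extended by 0 outside K); every such absolute value is the restriction
   of some ||.||_y, y a place of Qbar above p *)
Definition place_of (K : set algC) (p : nat) (v : algC -> R) : Prop :=
  exists y, absval_over p y /\ v = restr K y.

Variable S : set nat.   (* a set of primes = non-archimedean places of Q *)

Definition Xset : set (algC -> R) := [set y | exists2 p, S p & absval_over p y].

Definition MK (K : set algC) : set (algC -> R) :=
  [set v | exists2 p, S p & place_of K p v].

Definition Yset (K : set algC) (v : algC -> R) : set (algC -> R) :=
  [set y | Xset y /\ restr K y = v].

Definition consistent (c : set algC -> (algC -> R) -> R) : Prop :=
  forall K v L, number_field K -> MK K v -> number_field L -> K `<=` L ->
    c K v = \sum_(w \in [set w | MK L w /\ restr K w = v]) c L w.

Definition fval (f : (algC -> R) -> R) (K : set algC) (v : algC -> R) : R :=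
  xget 0 [set r | exists y, Yset K v y /\ f y = r].

Definition adapted (f : (algC -> R) -> R) (K : set algC) : Prop :=
  [/\ number_field K,
      (forall v, MK K v -> forall y z, Yset K v y -> Yset K v z -> f y = f z) &
      finite_set [set v | MK K v /\ fval f K v != 0]].

Definition Phi_is (c : set algC -> (algC -> R) -> R) (f : (algC -> R) -> R) (r : R) :=
  exists K, adapted f K /\ r = \sum_(v \in MK K) c K v * fval f K v.

(* Phi_c(f) (well defined, independent of K, for c consistent) *)
Definition Phi (c : set algC -> (algC -> R) -> R) (f : (algC -> R) -> R) : R :=
  xget 0 [set r | Phi_is c f r].

Definition flog (a : algC) : (algC -> R) -> R := fun y => ln (y a).

End Defs.

Definition is_rat {R : realType} (x : R) : Prop := exists q : rat, x = ratr q.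

(* Main.v *)
Require Import Defs.
From HB Require Import structures.
From mathcomp Require Import all_boot all_order all_algebra all_field.
From mathcomp Require Import all_classical all_reals.
From mathcomp Require Import exp.
From mathcomp Require Import fingroup ring lra zify.
Import Order.TTheory GRing.Theory Num.Theory.
Local Open Scope ring_scope.
Local Open Scope classical_set_scope.

(** An absolute value [y] over [p] is ultrametric, and two terms of a vanishing
    rational polynomial in [a] must share the largest absolute value, so [y a] is
    a rational power of [p]; this gives the "if" direction term by term.

    Conversely, by consistency it suffices to treat a Galois number field [L].
    If some [a] in [L] has [v a < 1] and absolute value 1 at every other place of
    [L], then [Phi_c (f_a) = c(L, v) log (v a)], a nonzero rational multiple of
    [c(L, v) log p].  Such an [a] comes from finiteness of the class group in
    Hurwitz' form: for some [M], every nonzero ideal [I] contains [b] with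
    [M I] contained in [b O]; the ideals [(M / b) I] contain [M], so they take
    finitely many values, and two of the ideals [{v <= p^-m}] differ by a
    principal factor [a].  That [Phi_c] does not depend on the field used to
    compute it needs finitely many places above [p], which holds because a place
    is determined by its maximal ideal, a union of classes of [O / p O]. *)

(* [t ^+ k] grows faster than linearly in [k] when [t > 1]. *)
Lemma le1_of_expr_le_linear (R : realType) (t : R) :
  0 <= t -> (forall k, t ^+ k <= k.+1%:R) -> t <= 1.
Proof.
move=> t0 ht; rewrite leNgt; apply/negP => t1.
pose d := t - 1; have d0 : 0 < d by rewrite subr_gt0.
have bern k : 1 + k%:R * d <= t ^+ k.
  elim: k => [|k IHk]; first by rewrite mul0r addr0 expr0.
  have T1 : 1 <= t ^+ k by rewrite exprn_ege1 ?ltW.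
  rewrite exprS -natr1; move: (t ^+ k) T1 IHk => T; move: (k%:R) => K.
  by rewrite /d; nra.
(* Bernoulli's bound is only linear, so it is squared at exponent [k + k]: the term [k^2 d^2]
   exceeds [2k] as soon as [k d^2 > 2]. *)
pose k := (Num.truncn (2 / d ^+ 2)).+1.
have hk : 2 / d ^+ 2 < k%:R by rewrite Num.Theory.truncnS_gt.
have := ht (k + k)%N; apply/negP; rewrite -ltNge exprD.
apply: (@lt_le_trans _ _ ((1 + k%:R * d) * (1 + k%:R * d))); last first.
  by apply: ler_pM => //; rewrite addr_ge0 ?mulr_ge0 // ltW.
rewrite ltr_pdivrMr ?exprn_gt0 // in hk.
have k0 : 0 < (k%:R : R) by rewrite ltr0n.
rewrite -natr1 natrD.
have : k%:R * 2 < k%:R * (k%:R * d ^+ 2) by rewrite ltr_pM2l.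
have : 0 < k%:R * d by rewrite mulr_gt0.
by move: (k%:R) => K; rewrite expr2; nra.
Qed.

Lemma pigeonhole_nat {T : finType} (f : nat -> T) {n : nat} : (#|T| <= n)%N ->
  exists i j, [/\ (i < j)%N, (j <= n)%N & f i = f j].
Proof.
move=> Tn; suff [i [j [ij fij]]] : exists i j : 'I_n.+1, (i < j)%N /\ f i = f j.
  by exists i, j; split=> //; rewrite -ltnS.
apply: contrapT => no.
have /leq_card : injective (fun i : 'I_n.+1 => f i).
  move=> i j fij; apply: val_inj => /=; case: (ltngtP i j) => // ij.
    by case: no; exists i, j.
  by case: no; exists j, i.
by rewrite card_ord ltnNge Tn.
Qed.

(** * Absolute values on the algebraic numbers *)

Section AbsoluteValues.
Set Implicit Arguments.
Unset Strict Implicit.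
Variables (R : realType) (p : nat) (y : algC -> R).
Hypotheses (p_pr : prime p) (hy : absval_over p y).

Lemma prime_real_gt0 : 0 < (p%:R : R).
Proof. by rewrite ltr0n prime_gt0. Qed.
Let p_gt0 := prime_real_gt0.

Lemma prime_real_gt1 : 1 < (p%:R : R).
Proof. by rewrite ltr1n prime_gt1. Qed.
Let p_gt1 := prime_real_gt1.

Lemma absval0 : y 0 = 0.
Proof. by case: hy => h _ _ _; apply/h. Qed.

Lemma absval_eq0 x : (y x == 0) = (x == 0).
Proof. by case: hy => h _ _ _; apply/eqP/eqP => /h. Qed.

Lemma absvalM x z : y (x * z) = y x * y z.
Proof. by case: hy. Qed.

Lemma absvalD x z : y (x + z) <= y x + y z.
Proof. by case: hy. Qed.

Lemma absval_rat q : y (ratr q) = padic_abs R p q.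
Proof. by case: hy. Qed.

Lemma absval_int (z : int) : z != 0 -> y z%:~R = p%:R ^- logn p `|z|.
Proof.
move=> z0; rewrite -ratr_int absval_rat /padic_abs intr_eq0 (negPf z0).
by rewrite numq_int denq_int logn1 sub0r -exprnN.
Qed.

Lemma absval1 : y 1 = 1.
Proof. by rewrite (@absval_int 1) // logn1 expr0 invr1. Qed.

Lemma absvalN x : y (- x) = y x.
Proof.
by rewrite -mulN1r absvalM (@absval_int (-1)) // logn1 expr0 invr1 mul1r.
Qed.

Lemma absval_ge0 x : 0 <= y x.
Proof.
rewrite -(@pmulrn_lge0 _ _ 2) // mulr2n -{2}absvalN -absval0 -(subrr x).
exact: absvalD.
Qed.

Lemma absval_gt0 x : (0 < y x) = (x != 0).
Proof. by rewrite lt_neqAle eq_sym absval_eq0 absval_ge0 andbT. Qed.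

Lemma absvalX x n : y (x ^+ n) = y x ^+ n.
Proof.
elim: n => [|n IHn]; first by rewrite !expr0 absval1.
by rewrite !exprS absvalM IHn.
Qed.

Lemma absvalV x : y x^-1 = (y x)^-1.
Proof.
have [->|x0] := eqVneq x 0; first by rewrite invr0 absval0 invr0.
by apply: (@mulfI _ (y x)); rewrite ?absval_eq0 // -absvalM !divff ?absval_eq0 ?absval1.
Qed.

Lemma absval_int_le1 (z : int) : y z%:~R <= 1.
Proof.
have [->|z0] := eqVneq z 0; first by rewrite absval0 ler01.
by rewrite absval_int // invf_le1 ?exprn_gt0 // exprn_ege1 // ltW.
Qed.

Lemma absval_nat_le1 n : y n%:R <= 1.
Proof. exact: (absval_int_le1 n). Qed.

Lemma absval_int_lt1 (z : int) : y z%:~R < 1 -> (p %| z)%Z.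
Proof.
have [->|z0] := eqVneq z 0; first by rewrite dvdz0.
rewrite absval_int // invf_lt1 ?exprn_gt0 //.
rewrite dvdzE absz_nat -[X in dvdn X](expn1 p) pfactor_dvdn ?absz_gt0 // lt0n.
by apply: contraTneq => ->; rewrite expr0 ltxx.
Qed.

Lemma absval_prime : y p%:R = p%:R^-1.
Proof.
by rewrite (@absval_int p) ?absz_nat ?logn_prime ?eqxx ?expr1 // eqz_nat -lt0n prime_gt0.
Qed.

Lemma absval_other_prime l : prime l -> l != p -> y l%:R = 1.
Proof.
move=> l_pr lp; rewrite (@absval_int l) ?eqz_nat -?lt0n ?prime_gt0 //.
by rewrite absz_nat logn_prime // eq_sym (negPf lp) expr0 invr1.
Qed.

Lemma absval_sum_le I (r : seq I) (P : pred I) (F : I -> algC) :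
  y (\sum_(i <- r | P i) F i) <= \sum_(i <- r | P i) y (F i).
Proof.
elim/big_rec2: _ => [|i a b _ ab]; first by rewrite absval0.
by rewrite (le_trans (absvalD _ _)) // lerD2l.
Qed.

(** Binomial coefficients have absolute value at most 1, so [y (x + z) ^+ k] is at most
    [(k + 1) b^k], and growth in [k] forces [y (x + z) / b <= 1]. *)
Lemma absval_ultra x z b : y x <= b -> y z <= b -> y (x + z) <= b.
Proof.
move=> hx hz; have b0 := le_trans (absval_ge0 x) hx.
have [b_eq|bn0] := eqVneq b 0.
  move: hx hz; rewrite b_eq !le_eqVlt !ltNge !absval_ge0 !absval_eq0 /= !orbF.
  by move=> /eqP-> /eqP->; rewrite addr0.
have bp : 0 < b by rewrite lt_neqAle eq_sym bn0.
rewrite -[b]mul1r -ler_pdivrMr //; apply: le1_of_expr_le_linear => [|k].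
  by rewrite divr_ge0 ?absval_ge0.
rewrite expr_div_n ler_pdivrMr ?exprn_gt0 // -absvalX exprDn.
apply: (le_trans (absval_sum_le _ _ _)).
apply: (@le_trans _ _ (\sum_(i < k.+1) b ^+ k)); last first.
  by rewrite sumr_const card_ord mulr_natl.
apply: ler_sum => i _; rewrite -mulr_natl !absvalM !absvalX.
rewrite -[leRHS]mul1r; apply: ler_pM; rewrite ?mulr_ge0 ?exprn_ge0 ?absval_ge0 //.
  exact: absval_nat_le1.
have -> : b ^+ k = b ^+ (k - i) * b ^+ i by rewrite -exprD subnK // -ltnS.
by rewrite ler_pM ?exprn_ge0 ?absval_ge0 // lerXn2r ?nnegrE ?absval_ge0.
Qed.

Lemma absval_ultra_lt x z b : y x < b -> y z < b -> y (x + z) < b.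
Proof.
move=> hx hz; apply: (@le_lt_trans _ _ (Num.max (y x) (y z))).
  by apply: absval_ultra; rewrite le_max lexx ?orbT.
by rewrite gt_max hx.
Qed.

Lemma absval_ultra_sum_lt I (r : seq I) (P : pred I) (F : I -> algC) b :
  0 < b -> (forall i, P i -> y (F i) < b) -> y (\sum_(i <- r | P i) F i) < b.
Proof.
move=> b0 hF; elim/big_ind: _ => [|u v|//]; first by rewrite absval0.
exact: absval_ultra_lt.
Qed.

(** If [y x > 1], the leading term of the monic integral minimal polynomial strictly dominates the
    others, so their sum cannot vanish. *)
Lemma absval_Aint_le1 x : x \in Aint -> y x <= 1.
Proof.
move=> Ax; rewrite leNgt; apply/negP => x1.
have := root_minCpoly x; rewrite /root horner_coef.
have szq : (0 < size (minCpoly x))%N by rewrite lt0n size_poly_eq0 monic_neq0 ?minCpoly_monic.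
rewrite -(prednK szq) big_ord_recr /= -lead_coefE (monicP (minCpoly_monic x)) mul1r addrC addr_eq0.
set n := (_.-1) => /eqP e.
suff : y (\sum_(i < n) (minCpoly x)`_i * x ^+ i) < y x ^+ n.
  by rewrite -absvalN -e absvalX ltxx.
apply: absval_ultra_sum_lt.
  by rewrite exprn_gt0 // (lt_trans ltr01).
move=> i _; rewrite absvalM absvalX.
have /intrP[z ->] : (minCpoly x)`_i \in Num.int by have /polyOverP -> := Ax.
apply: (@le_lt_trans _ _ (y x ^+ i)).
  by rewrite ler_piMl ?absval_int_le1 ?exprn_ge0 ?absval_ge0.
by rewrite ltr_eXn2l.
Qed.

Lemma absval_rat_expz (q : rat) : q != 0 -> exists z : int, y (ratr q) = p%:R ^ z.
Proof. by move=> q0; rewrite absval_rat /padic_abs (negPf q0); eexists. Qed.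

(* Two terms of a vanishing sum share the largest absolute value. *)
Lemma absval_expr_prime (x : algC) : x != 0 ->
  exists n (z : int), (0 < n)%N /\ y x ^+ n = p%:R ^ z.
Proof.
move=> x0; have [q [Dq q_mon] _] := minCpolyP x.
have q0 := monic_neq0 q_mon.
have szq : (0 < size q)%N by rewrite lt0n size_poly_eq0.
have : root (minCpoly x) x := root_minCpoly x.
rewrite /root Dq horner_coef size_map_poly => /eqP e.
pose a (i : nat) : rat := q`_i.
pose T (i : 'I_(size q)) := ratr (a i) * x ^+ i : algC.
have T0 : \sum_i T i = 0.
  by rewrite -[RHS]e; apply: eq_bigr => i _; rewrite coef_map.
have lt_pred : ((size q).-1 < size q)%N by rewrite prednK.
pose i0 := Ordinal lt_pred.
have qi0 : a i0 != 0 by rewrite /a -lead_coefE (monicP q_mon) oner_eq0.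
have [i [qi max_i]] : exists i : 'I_(size q),
    a i != 0 /\ forall j : 'I_(size q), a j != 0 -> y (T j) <= y (T i).
  by case: (@arg_maxP _ R _ i0 (fun i => a i != 0) (fun i => y (T i)) qi0) => i; exists i.
have Ti : 0 < y (T i) by rewrite absval_gt0 mulf_neq0 ?expf_neq0 // fmorph_eq0.
have [j [jnei qj Tij]] : exists j, [/\ j != i, a j != 0 & y (T j) = y (T i)].
  (* Otherwise [T i] would strictly dominate the sum of the other terms, which equals [- T i]. *)
  apply: contrapT => noj; have : y (\sum_(j | j != i) T j) < y (T i).
    apply: absval_ultra_sum_lt => // j ji; have [qj|qj] := eqVneq (a j) 0.
      by rewrite /T qj rmorph0 mul0r absval0.
    rewrite lt_neqAle max_i // andbT; apply/eqP => Tij; apply: noj.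
    by exists j.
  move: T0; rewrite (bigD1 i) //= => /eqP; rewrite addr_eq0 => /eqP ->.
  by rewrite absvalN ltxx.
have [zi Dzi] := absval_rat_expz qi; have [zj Dzj] := absval_rat_expz qj.
have pn0 : p%:R != 0 :> R by rewrite gt_eqF.
have yxn0 : y x != 0 by rewrite absval_eq0.
have main (k l : nat) (u w : int) : (k < l)%N ->
    p%:R ^ u * y x ^+ k = p%:R ^ w * y x ^+ l ->
    exists n (z : int), (0 < n)%N /\ y x ^+ n = p%:R ^ z.
  move=> kl eqn; exists (l - k)%N, (u - w); split; first by rewrite subn_gt0.
  have wn0 : p%:R ^ w != 0 :> R by rewrite expfz_neq0.
  apply: (mulfI wn0); apply: (@mulIf _ (y x ^+ k)); first by rewrite expf_neq0.
  by rewrite -mulrA -exprD subnK 1?ltnW // -eqn -expfzDr // subrKC.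
move: Tij; rewrite /T absvalM [in RHS]absvalM Dzi Dzj !absvalX => Tij.
have [ltij|ltji|eqij] := ltngtP i j.
- exact: main ltij (esym Tij).
- exact: main ltji Tij.
- by rewrite -val_eqE /= eqij eqxx in jnei.
Qed.

Lemma ln_absval (x : algC) : x != 0 -> exists q : rat, ln (y x) = ratr q * ln p%:R.
Proof.
move=> x0; have [n [z [n0 e]]] := absval_expr_prime x0.
exists (z%:~R / n%:R); apply: (@mulfI _ n%:R); first by rewrite pnatr_eq0 -lt0n.
rewrite rmorphM fmorphV rmorph_nat /= ratr_int mulrA mulrCA divff ?pnatr_eq0 -?lt0n // mulr1.
rewrite mulr_natl -lnXn ?absval_gt0 // e.
case: z {e} => k; first by rewrite -exprnP lnXn // mulr_natl.
by rewrite NegzE -exprnN lnV ?posrE ?exprn_gt0 // lnXn // mulNr mulr_natl.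
Qed.
End AbsoluteValues.

(** * Algebraic integers *)

Section IntegralMultiples.
Set Implicit Arguments.
Unset Strict Implicit.
Implicit Types (f : {poly int}) (b : algC).

(** The Horner tail [f_k + f_(k+1) b + ...]. For a root [b] of [f] these tails supply integral
    multiples of [b]. *)
Definition tail_eval f b k : algC := (map_poly intr (drop_poly k f)).[b].

Lemma tail_eval_rec f b k : tail_eval f b k = (f`_k)%:~R + b * tail_eval f b k.+1.
Proof.
have -> : tail_eval f b k = (map_poly intr ((f`_k)%:P + 'X * drop_poly k.+1 f)).[b].
  congr (map_poly intr _).[b]; apply/polyP => i; rewrite coefD coefC coefXM !coef_drop_poly.
  by case: i => [|i] /=; rewrite ?addr0 ?add0r // addSnnS.
by rewrite rmorphD rmorphM /= map_polyC map_polyX hornerD hornerM hornerC hornerX.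
Qed.

Lemma tail_eval0 f b : tail_eval f b 0 = (map_poly intr f).[b].
Proof. by rewrite /tail_eval drop_poly0l. Qed.

Lemma tail_eval_oversize f b k : (size f <= k)%N -> tail_eval f b k = 0.
Proof. by move=> h; rewrite /tail_eval drop_poly_eq0 // rmorph0 horner0. Qed.

Lemma horner_tail_eval f b k :
  (map_poly intr f).[b] = \sum_(i < k) (f`_i)%:~R * b ^+ i + b ^+ k * tail_eval f b k.
Proof.
elim: k => [|k IHk]; first by rewrite big_ord0 expr0 mul1r add0r tail_eval0.
by rewrite {}IHk tail_eval_rec big_ord_recr /= mulrDr addrA [_ * b ^+ k]mulrC exprSr mulrA.
Qed.

Lemma Aint_integralOver (x : algC) : x \in Aint -> integralOver (intr : int -> algC) x.
Proof.
move=> Ax; have /floorpP[q Dq] := Ax.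
exists q; last by rewrite -Dq root_minCpoly.
have := minCpoly_monic x; rewrite Dq !monicE lead_coef_map_inj //; last exact: intr_inj.
by rewrite -[1]/(1%:~R) eqr_int.
Qed.

Lemma integralOver_Aint (x : algC) : integralOver (intr : int -> algC) x -> x \in Aint.
Proof.
case=> q q_mon qx; apply: root_monic_Aint qx _ _; first exact: monic_map.
by apply/polyOverP => i; rewrite coef_map rpred_int.
Qed.

Lemma root_monic_over_Aint (g : {poly algC}) x :
  root g x -> g \is monic -> g \is a polyOver Aint -> x \in Aint.
Proof.
move=> gx g_mon /polyOverP gA; apply: integralOver_Aint.
apply: (integral_root_monic g_mon gx) => _ /(nthP 0)[i _ <-].
exact: Aint_integralOver.
Qed.

(* With [U] the tail, [b * U] is a root of
   [X^k + sum_(i < k) f_i U^(k-1-i) X^i]. *)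
Lemma Aint_tail_eval f b k : root (map_poly intr f) b -> (0 < k)%N ->
  tail_eval f b k \in Aint /\ b * tail_eval f b k \in Aint.
Proof.
move=> fb; have [m] := ubnP (size f - k)%N; elim: m k => // m IHm k km k0.
have Uk : tail_eval f b k \in Aint.
  have [le|lt] := leqP (size f) k; first by rewrite tail_eval_oversize // Aint0.
  have [||_ h] := IHm k.+1 => //; first by rewrite subnS; lia.
  by rewrite tail_eval_rec rpredD // Aint_int.
split=> //; set U := tail_eval f b k in Uk *.
pose g := \poly_(i < k) ((f`_i)%:~R * U ^+ (k.-1 - i)).
apply: (@root_monic_over_Aint ('X^k + g)).
- rewrite /root hornerD hornerXn horner_poly.
  have := horner_tail_eval f b k; rewrite (rootP fb) -/U => /esym h.
  have : U ^+ k.-1 * (\sum_(i < k) (f`_i)%:~R * b ^+ i + b ^+ k * U) = 0 by rewrite h mulr0.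
  rewrite mulrDr mulrCA -[X in b ^+ k * X]exprSr prednK // -exprMn addrC => e.
  rewrite -[X in _ == X]e; apply/eqP; congr (_ + _); rewrite mulr_sumr.
  apply: eq_bigr => i _; have -> : U ^+ k.-1 = U ^+ (k.-1 - i) * U ^+ i.
    by rewrite -exprD; congr (_ ^+ _); have := ltn_ord i; lia.
  by rewrite exprMn; ring.
- rewrite monicE lead_coefDl ?lead_coefXn // size_polyXn ltnS; exact: size_poly.
- apply/polyOverP => i; rewrite coefD coefXn coef_poly rpredD //.
    exact: rpred_nat.
  case: ifP => _; last exact: Aint0.
  by apply: rpredM; [exact: Aint_int | exact: rpredX].
Qed.

(** Primitivity is what later prevents [p] from dividing every coefficient. *)
Lemma primitive_int_poly b : exists f : {poly int},
  [/\ f != 0, zcontents f = 1 & root (map_poly intr f) b].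
Proof.
have [q [Dq q_mon] _] := minCpolyP b.
have [f [a a0 Df]] := rat_poly_scale q.
have f0 : f != 0.
  apply: contraTneq q_mon => f0; rewrite Df f0 rmorph0 scaler0.
  by rewrite monicE lead_coef0 eq_sym oner_eq0.
have z0 : zcontents f != 0 by rewrite zcontents_eq0.
exists (zprimitive f); split.
- by rewrite zprimitive_eq0.
- by rewrite zcontents_primitive f0.
have := root_minCpoly b; rewrite Dq Df linearZ_LR /= -map_poly_comp.
rewrite (eq_map_poly (_ : _ =1 intr)); last by move=> z /=; rewrite ratr_int.
rewrite rootZ ?fmorph_eq0 ?invr_eq0 ?intr_eq0 // {1}(zpolyEprim f) linearZ_LR /= rootZ //.
by rewrite intr_eq0.
Qed.

(** The last tail is the leading coefficient, so [Aint_tail_eval] at the degree makes its product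
    with [b] integral. *)
Lemma int_multiple_Aint b : exists2 d : int, d != 0 & d%:~R * b \in Aint.
Proof.
have [f [f0 _ fb]] := primitive_int_poly b.
have sz : (1 < size f)%N.
  rewrite ltnNge; apply: contraL fb => /size1_polyC Df.
  by rewrite Df map_polyC rootC intr_eq0 -polyC_eq0 -Df.
exists (lead_coef f); first by rewrite lead_coef_eq0.
have [|_] := @Aint_tail_eval f b (size f).-1 fb; first by lia.
by rewrite tail_eval_rec tail_eval_oversize ?mulr0 ?addr0 1?mulrC //; lia.
Qed.

(** If all tails [U_k] with [k > 0] had absolute value below 1, so would every coefficient
    [f_i = U_i - b U_(i+1)], and [p] would divide a primitive polynomial. The multiplier is a
    polynomial in [b] so that it stays in any field containing [b]. *)
Lemma unit_absval_integral_multiple (R : realType) (p : nat) (y : algC -> R) b :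
  prime p -> absval_over p y -> y b <= 1 ->
  exists q : {poly int}, let u := (map_poly intr q).[b] in
  [/\ u \in Aint, b * u \in Aint & y u = 1].
Proof.
move=> p_pr hy yb; have [f [f0 f1 fb]] := primitive_int_poly b.
suff [k [k0 yk]] : exists k, (0 < k)%N /\ 1 <= y (tail_eval f b k).
  have [A1 A2] := Aint_tail_eval fb k0; exists (drop_poly k f); split=> //.
  by apply/eqP; rewrite eq_le yk andbT (absval_Aint_le1 p_pr hy).
apply: contrapT => no.
have small k : (0 < k)%N -> y (tail_eval f b k) < 1.
  by move=> k0; rewrite ltNge; apply/negP => ?; apply: no; exists k.
have : (p %| zcontents f)%Z.
  rewrite dvdz_contents; apply/polyOverP => i; apply: (absval_int_lt1 p_pr hy).
  have -> : (f`_i)%:~R = tail_eval f b i - b * tail_eval f b i.+1.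
    by rewrite (tail_eval_rec f b i) addrK.
  apply: (absval_ultra_lt p_pr hy).
    case: i => [|i]; last exact: small.
    by rewrite tail_eval0 (rootP fb) (absval0 hy) ltr01.
  rewrite (absvalN hy) (absvalM hy).
  apply: le_lt_trans (small i.+1 isT).
  by rewrite ler_piMl // (absval_ge0 hy).
by rewrite f1 dvdz1 /= => /eqP pe; move: p_pr; rewrite pe.
Qed.
End IntegralMultiples.

(** Adjoin all roots of the product of the rational minimal polynomials of [s]: this is a splitting
    field, separable in characteristic 0. *)
Lemma galois_number_field (s : seq algC) :
  exists (L : splittingFieldType rat) (iota : {rmorphism L -> algC}),
    galois 1 {:L} /\ forall x, x \in s -> exists a, iota a = x.
Proof.
have [P P_mon sP] : exists2 P : {poly rat}, P \is monic &
    forall x, x \in s -> root (map_poly ratr P) x.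
  elim: s => [|x s [P P_mon sP]]; first by exists 1; rewrite ?monic1.
  have [q [Dq q_mon] _] := minCpolyP x.
  exists (q * P); first by rewrite monicMr.
  move=> z; rewrite inE rmorphM /= rootM => /predU1P[->|/sP ->]; last exact: orbT.
  by rewrite -Dq root_minCpoly.
have [r Dr] := closed_field_poly_normal (map_poly ratr P : {poly algC}).
have {}Dr : map_poly ratr P = \prod_(z <- r) ('X - z%:P) :> {poly algC}.
  by rewrite Dr (monicP _) ?map_monic // scale1r.
have [Qs [QsC [s1 Ds1 genQs]]] := num_field_exists r.
pose P1 : {poly Qs} := map_poly (in_alg Qs) P.
have DP1 : P1 = \prod_(z <- s1) ('X - z%:P).
  apply: (map_poly_inj QsC); rewrite rmorph_prod /= -map_poly_comp.
  rewrite (eq_map_poly (_ : _ =1 ratr)); last first.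
    by move=> a /=; rewrite alg_num_field fmorph_rat.
  rewrite Dr -Ds1 big_map; apply: eq_bigr => z _.
  by rewrite rmorphB /= map_polyX map_polyC.
have splitP1 : splittingFieldFor 1 P1 {:Qs} by exists s1; rewrite ?DP1 ?eqpxx.
have P1over : P1 \is a polyOver 1%AS.
  by apply/polyOverP => i; rewrite coef_map /= memvZ ?mem1v.
have Qs_ax : FieldExt_isSplittingField _ Qs by constructor; exists P1.
exists (HB.pack_for (splittingFieldType rat) Qs Qs_ax), QsC; split.
  rewrite /galois sub1v normalFieldf andbT /=.
  by apply/separableP => u _; apply: pcharf0_separable => p; rewrite pchar_lalg pchar_num.
move=> x /sP; rewrite Dr root_prod_XsubC -Ds1 => /mapP[a _ ->].
by exists a.
Qed.

(** * Ideals and places of a Galois number field *)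

Section GaloisField.
Set Implicit Arguments.
Unset Strict Implicit.
Variables (L : splittingFieldType rat) (iota : {rmorphism L -> algC}).
Hypothesis galL : galois 1 {:L}.

Local Notation Tr := (galTrace 1 {:L}).
Local Notation N := (galNorm 1 {:L}).
Local Notation OL x := (iota x \in Aint).

Lemma OL_int (z : int) : OL z%:~R.
Proof. by rewrite rmorph_int Aint_int. Qed.

Lemma OL_nat (n : nat) : OL n%:R.
Proof. exact: (OL_int n). Qed.

Lemma OL_D x z : OL x -> OL z -> OL (x + z).
Proof. by move=> Ox Oz; rewrite rmorphD rpredD. Qed.

Lemma OL_B x z : OL x -> OL z -> OL (x - z).
Proof. by move=> Ox Oz; rewrite rmorphB rpredB. Qed.

Lemma OL_M x z : OL x -> OL z -> OL (x * z).
Proof. by move=> Ox Oz; rewrite rmorphM rpredM. Qed.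

Lemma OL_X x n : OL x -> OL (x ^+ n).
Proof. by move=> Ox; rewrite rmorphXn rpredX. Qed.

Lemma OL_sum I (r : seq I) (P : pred I) (F : I -> L) :
  (forall i, P i -> OL (F i)) -> OL (\sum_(i <- r | P i) F i).
Proof. by move=> OF; rewrite rmorph_sum rpred_sum. Qed.

Lemma OL_gal (g : gal_of {:L}) x : OL x -> OL (g x).
Proof.
by have [nu Dnu] := extend_algC_subfield_aut iota g; rewrite Dnu Aint_aut.
Qed.

Lemma OL_rat (a : L) : a \in 1%VS -> OL a -> exists z : int, a = z%:~R.
Proof.
move=> /vlineP[k Dk] Oa; have : iota a \in Num.int.
  by apply: Cint_rat_Aint => //; rewrite Dk rmorphZ_num rmorph1 mulr1 Crat_rat.
by move=> /intrP[z Dz]; exists z; apply: (fmorph_inj iota); rewrite Dz rmorph_int.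
Qed.

Lemma trace_int x : OL x -> exists z : int, Tr x = z%:~R.
Proof.
move=> Ox; apply: OL_rat; first by rewrite mem_galTrace ?memvf.
by apply: OL_sum => g _; apply: OL_gal.
Qed.

Lemma norm_int x : OL x -> exists z : int, N x = z%:~R.
Proof.
move=> Ox; apply: OL_rat; first by rewrite mem_galNorm ?memvf.
by rewrite rmorph_prod rpred_prod // => g _; apply: OL_gal.
Qed.

Lemma traceZ a x : Tr (a *: x) = a *: Tr x.
Proof. by rewrite /galTrace scaler_sumr; apply: eq_bigr => g _; rewrite linearZ. Qed.

(** Testing against [x^-1] gives the trace of 1, the order of the Galois group, which is nonzero. *)
Lemma trace_form_nondegenerate x : (forall z, Tr (x * z) = 0) -> x = 0.
Proof.
move=> tr0; apply: contrapT => /eqP x0; have := tr0 x^-1.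
rewrite divff // /galTrace; under eq_bigr do rewrite rmorph1.
rewrite sumr_const => /(congr1 iota) /eqP.
by rewrite rmorph_nat rmorph0 pnatr_eq0 eqn0Ngt cardG_gt0.
Qed.

(** A rational basis of [L], each vector scaled by an integer that makes it integral. *)
Lemma integral_generators : exists n (e : 'I_n -> L) (r : L -> 'I_n -> rat),
  (forall i, OL (e i)) /\ forall x, x = \sum_i r x i *: e i.
Proof.
pose b i := (vbasis {:L})`_i.
have /choice[d hd] (i : 'I_(\dim {:L})) : exists d : int, d != 0 /\ OL (d%:~R * b i).
  by have [d d0 Od] := int_multiple_Aint (iota (b i)); exists d; rewrite rmorphM rmorph_int.
exists (\dim {:L}), (fun i => (d i)%:~R * b i), (fun x i => coord (vbasis {:L}) i x / (d i)%:~R).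
split=> [i|x]; first by case: (hd i).
rewrite {1}(coord_vbasis (memvf x)); apply: eq_bigr => i _.
have [d0 _] := hd i; have -> : (d i)%:~R * b i = ((d i)%:~R : rat) *: b i.
  by rewrite scaler_int mulrzl.
by rewrite scalerA divfK // intr_eq0.
Qed.

(* A number reduced to coordinates in [0, M) has bounded integral traces against
   the generators, and these traces determine it. *)
Lemma integral_residues (M : nat) : (0 < M)%N ->
  exists (T : finType) (h : L -> T), forall x z, OL x -> OL z -> h x = h z ->
    OL ((x - z) / M%:R).
Proof.
move=> M0; have [n [e [r [Oe re]]]] := integral_generators.
have M0q : 0 < (M%:R : rat) by rewrite ltr0n.
pose fl x i : int := Num.floor (r x i / M%:R).
pose rho x i : rat := r x i - M%:R * (fl x i)%:~R.
have rho_ge0 x i : 0 <= rho x i.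
  by rewrite subr_ge0 mulrC -ler_pdivlMr // Num.Theory.floor_le.
have rho_lt x i : rho x i < M%:R.
  rewrite ltrBlDr -[X in X + _]mulr1 -mulrDr mulrC -ltr_pdivrMr // addrC.
  by rewrite -[1]/(1%:~R) -intrD Num.Theory.floorD1_gt.
pose red x := \sum_i rho x i *: e i.
pose quo x := \sum_i (fl x i)%:~R * e i.
have redE x : x = red x + M%:R * quo x.
  rewrite {1}(re x) /red /quo mulr_sumr -big_split /=; apply: eq_bigr => i _.
  have -> : M%:R * ((fl x i)%:~R * e i) = (M%:R * (fl x i)%:~R : rat) *: e i.
    by rewrite -scalerA scaler_int scaler_nat mulr_natl mulrzl.
  by rewrite -scalerDl subrK.
have Oquo x : OL (quo x) by apply: OL_sum => i _; apply: OL_M => //; apply: OL_int.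
have Ored x : OL x -> OL (red x).
  move=> Ox; have -> : red x = x - M%:R * quo x by rewrite {2}(redE x) addrK.
  by apply: OL_B => //; apply: OL_M => //; apply: OL_nat.
have /choice[t ht] (ij : 'I_n * 'I_n) : exists z : int, Tr (e ij.1 * e ij.2) = z%:~R.
  by apply: trace_int; apply: OL_M.
pose tr x j : rat := \sum_i rho x i * (t (i, j))%:~R.
have trE x j : Tr (red x * e j) = (tr x j)%:A.
  rewrite /red mulr_suml raddf_sum scaler_suml; apply: eq_bigr => i _.
  by rewrite -scalerAl [LHS]traceZ (ht (i, j)) -scalerA scaler_int.
(* Since [0 <= rho < M], the trace at [j] is at most [sum_i M |t(i, j)|]; summing over [j] gives one
   bound for all. *)
pose C : nat := (\sum_j \sum_i M * `|t (i, j)|)%N.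
have tr_bound x j : `|tr x j| <= C%:R.
  apply: le_trans (ler_norm_sum _ _ _) _.
  apply: (@le_trans _ _ (\sum_i M * `|t (i, j)|)%N%:R); last first.
    by rewrite ler_nat /C [X in (_ <= X)%N](bigD1 j) //= leq_addr.
  rewrite natr_sum; apply: ler_sum => i _; rewrite normrM natrM.
  apply: ler_pM => //; first by rewrite ger0_norm // ltW.
  by rewrite natr_absz intr_norm.
have tr_int x j : OL x -> exists z : int, tr x j = z%:~R.
  move=> Ox; have [|z Dz] := @trace_int (red x * e j).
    by apply: OL_M => //; apply: Ored.
  exists z; apply/eqP; rewrite -(fmorph_eq (in_alg L)) /=.
  by rewrite -trE Dz scaler_int.
(* For integral [x] the floor is exact, and the shift by [C] moves [[-C, C]] to [[0, 2C]], so
   [inord] loses nothing. *)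
pose h x := [ffun j => inord (absz (Num.floor (tr x j) + C%:Z)%R) : 'I_(C + C).+1].
exists {ffun 'I_n -> 'I_(C + C).+1}, h => x z Ox Oz /ffunP hxz.
have trxz j : tr x j = tr z j.
  have := hxz j; rewrite !ffunE.
  have [u Du] := tr_int x j Ox; have [w Dw] := tr_int z j Oz.
  have := tr_bound x j; have := tr_bound z j; rewrite Du Dw !Num.Theory.intrKfloor.
  rewrite -!intr_norm -[C%:R]/(C%:Z%:~R) !ler_int => bw bu.
  move=> /(congr1 (@nat_of_ord _)); rewrite !inordK; try lia.
  by move=> uw; congr (_%:~R); lia.
(* With equal reductions, [x - z] is [M] times the integral difference of the quotients. *)
suff rxz : red x = red z.
  rewrite {1}(redE x) (redE z) rxz opprD addrACA subrr add0r -mulrBr mulrC mulKf; first exact: OL_B.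
  by rewrite -(fmorph_eq0 iota) rmorph_nat pnatr_eq0 -lt0n.
apply/eqP; rewrite -subr_eq0; apply/eqP/trace_form_nondegenerate => w.
rewrite (re w) mulr_sumr raddf_sum big1 // => j _ /=.
rewrite -scalerAr traceZ mulrBl raddfB /=.
by rewrite !trE trxz subrr scaler0.
Qed.
End GaloisField.

(** * Division in ideals and separation of places *)

Section GaloisIdeals.
Set Implicit Arguments.
Unset Strict Implicit.
Variables (L : splittingFieldType rat) (iota : {rmorphism L -> algC}).
Hypothesis galL : galois 1 {:L}.

Local Notation N := (galNorm 1 {:L}).
Local Notation OL x := (iota x \in Aint).

(* Hurwitz' substitute for the Euclidean algorithm. *)
Lemma norm_approximation : exists2 M : nat, (0 < M)%N &
  forall a : L, exists t w, [/\ (0 < t <= M)%N, OL w & `|iota (N (t%:R * a - w))| < 1].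
Proof.
have [n [e [r [Oe re]]]] := integral_generators iota.
(* A combination of the [e i] with rational coordinates at most [1/k] has its [g]-conjugate bounded
   by [S g / k]; taking [k] above every [S g] makes all conjugates smaller than 1. *)
pose S (g : gal_of {:L}) : algC := \sum_i `|iota (g (e i))|.
pose B : nat := (\sum_g Num.bound (S g))%N.
have SB g : S g < B.+1%:R.
  have S0 : 0 <= S g by apply: sumr_ge0 => i _; apply: normr_ge0.
  apply: (lt_le_trans (Num.Theory.archi_boundP S0)); rewrite ler_nat ltnW // ltnS.
  by rewrite /B (bigD1 g) //= leq_addr.
pose k := B.+1; exists (k ^ n)%N; first by rewrite expn_gt0.
move=> a; pose q (m : nat) i : rat := m%:R * r a i.
pose fr m i : rat := q m i - (Num.floor (q m i))%:~R.
have fr0 m i : 0 <= fr m i by rewrite subr_ge0 Num.Theory.floor_le.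
have fr1 m i : fr m i < 1.
  by rewrite ltrBlDr addrC -[1]/(1%:~R) -intrD Num.Theory.floorD1_gt.
have k0 : 0 < (k%:R : rat) by rewrite ltr0n.
(* [f m] records the box of side [1/k] holding the fractional parts of the coordinates of [m a]; two
   of the [k^n + 1] multiples share a box. *)
pose f m := [ffun i => inord (Num.truncn (k%:R * fr m i)) : 'I_k].
have [|m1 [m2 [m12 m2n /ffunP fE]]] := @pigeonhole_nat _ f (k ^ n)%N.
  by rewrite card_ffun !card_ord.
pose dl i : rat := fr m2 i - fr m1 i.
have dl_small i : `|dl i| <= k%:R^-1.
  have := fE i; rewrite !ffunE => /(congr1 (@nat_of_ord _)).
  have tr_lt m : (Num.truncn (k%:R * fr m i) < k)%N.
    by rewrite Num.Theory.truncn_lt_nat ?mulr_ge0 ?(ltW k0) // -[ltRHS]mulr1 ltr_pM2l.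
  rewrite !inordK // => trE; rewrite -(ler_pM2l k0) divff ?gt_eqF // -{1}[k%:R]gtr0_norm //.
  rewrite -normrM mulrBr.
  have itv m : (Num.truncn (k%:R * fr m i))%:R <= k%:R * fr m i < (Num.truncn (k%:R * fr m i)).+1%:R.
    by apply: Num.Theory.truncn_itv; rewrite mulr_ge0 // ltW.
  have := itv m1; have := itv m2; rewrite trE -natr1 ler_norml.
  move: (k%:R * fr m1 i) (k%:R * fr m2 i) (_%:R : rat) => u v T.
  by clear; lra.
pose w := \sum_i (Num.floor (q m2 i) - Num.floor (q m1 i))%:~R * e i.
exists (m2 - m1)%N, w; split.
- by rewrite subn_gt0 m12 (leq_trans (leq_subr _ _)).
- by apply: OL_sum => i _; apply: OL_M => //; apply: OL_int.
have -> : (m2 - m1)%:R * a - w = \sum_i dl i *: e i.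
  rewrite {1}(re a) mulr_sumr -sumrB; apply: eq_bigr => i _.
  rewrite mulr_natl -scaler_nat scalerA mulrzl -scaler_int -scalerBl; congr (_ *: _).
  by rewrite /dl /fr /q natrB 1?ltnW // intrB; ring.
set x := \sum_i _.
have gx (g : gal_of {:L}) : `|iota (g x)| < 1.
  rewrite /x [g _]linear_sum /= rmorph_sum /=; apply: le_lt_trans (ler_norm_sum _ _ _) _.
  apply: (@le_lt_trans _ _ (k%:R^-1 * S g)).
    rewrite mulr_sumr; apply: ler_sum => i _.
    rewrite [g _]linearZ rmorphZ_num normrM ler_wpM2r //.
    have -> : k%:R^-1 = ratr (k%:R^-1 : rat) :> algC by rewrite fmorphV rmorph_nat.
    by rewrite -ratr_norm ler_rat.
  by rewrite mulrC ltr_pdivrMr ?ltr0n // mul1r.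
rewrite rmorph_prod normr_prod (bigD1 1%g) ?group1 //=.
apply: le_lt_trans (gx 1%g); rewrite ler_piMr //.
suff /andP[_ //] : 0 <= \prod_(g in 'Gal({:L} / 1)%g | g != 1%g) `|iota (g x)| <= 1.
apply: (big_ind (fun u : algC => 0 <= u <= 1)) => [|u v /andP[u0 u1] /andP[v0 v1]|g _].
- by rewrite ler01 lexx.
- by rewrite mulr_ge0 // mulr_ile1.
- by rewrite normr_ge0 ltW.
Qed.

(** Take [b] in [I] of least nonzero absolute norm. For [x] in [I], approximating [x / b] gives
    [t x - w b] in [I] of smaller norm, hence zero. The factorial is a multiple of every possible
    [t]. *)
Lemma ideal_division : exists2 M : nat, (0 < M)%N & forall I : L -> Prop,
  (forall x, I x -> OL x) -> (forall x z, I x -> I z -> I (x - z)) ->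
  (forall x z, OL z -> I x -> I (z * x)) -> (exists2 x, I x & x != 0) ->
  exists b, [/\ I b, b != 0 & forall x, I x -> OL (M%:R * x / b)].
Proof.
have [M M0 hM] := norm_approximation; exists M`!; first exact: fact_gt0.
move=> I IO IB IM [x0 Ix0 x0n0].
have normn x : I x -> exists k : nat, `|iota (N x)| = k%:R.
  move=> Ix; have [z ->] := norm_int galL (IO _ Ix).
  by exists `|z|%N; rewrite rmorph_int natr_absz intr_norm.
pose P k := `[< exists x, [/\ I x, x != 0 & `|iota (N x)| = k%:R] >].
have exP : exists k, P k.
  by have [k Dk] := normn _ Ix0; exists k; apply/asboolP; exists x0.
case: (ex_minnP exP) => k /asboolP[b [Ib b0 Db]] kmin; exists b; split=> // x Ix.
have [t [w [/andP[t0 tM] Ow small]]] := hM (x / b).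
have Iy : I (t%:R * x - w * b) by apply: IB; apply: IM => //; apply: OL_nat.
have yE : t%:R * x - w * b = (t%:R * (x / b) - w) * b.
  by rewrite mulrBl mulrA divfK.
have y0 : t%:R * x - w * b = 0.
  apply: contrapT => /eqP yn0; have [j Dj] := normn _ Iy.
  have := kmin j; rewrite leqNgt; have -> : P j by apply/asboolP; eexists; split; eassumption.
  suff -> : (j < k)%N by move/(_ isT).
  rewrite -(ltr_nat algC) -Dj yE galNormM rmorphM normrM Db.
  by rewrite gtr_pMl // -Db normr_gt0 fmorph_eq0 galNorm_eq0.
have /dvdnP[s ->] : (t %| M`!)%N by apply: dvdn_fact; rewrite t0.
have -> : (s * t)%:R * x / b = s%:R * w.
  by rewrite natrM -mulrA -mulrA [t%:R * _]mulrA (subr0_eq y0) mulfK.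
by apply: OL_M => //; apply: OL_nat.
Qed.

(** A power of [x] times a power of [p] has value 1 at [y2] but not at [y1]; it or its inverse is
    some [c] below 1 at [y1]. Multiplying by an integral [u] with [y2 u = 1] and [c u] integral
    finishes. *)
Lemma separate_places (R : realType) (p : nat) (y1 y2 : algC -> R) x : prime p ->
  absval_over p y1 -> absval_over p y2 -> y1 (iota x) != y2 (iota x) ->
  exists b, [/\ OL b, y1 (iota b) < 1 & y2 (iota b) = 1].
Proof.
move=> p_pr h1 h2 x12.
have x0 : iota x != 0 by apply: contraNneq x12 => ->; rewrite (absval0 h1) (absval0 h2).
have [n [z [n0 Dz]]] := absval_expr_prime p_pr h2 x0.
have yp (y : algC -> R) : absval_over p y -> y (iota (p%:R ^ z)) = (p%:R ^ z)^-1.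
  move=> hy; have ypn k : y (iota (p%:R ^+ k)) = p%:R ^- k.
    by rewrite rmorphXn (absvalX hy) rmorph_nat (absval_prime p_pr hy) exprVn.
  case: z {Dz} => k; first exact: ypn.
  by rewrite NegzE -exprnN fmorphV (absvalV hy) ypn.
pose a := x ^+ n * p%:R ^ z.
have ya (y : algC -> R) : absval_over p y -> y (iota a) = y (iota x) ^+ n / y2 (iota x) ^+ n.
  by move=> hy; rewrite rmorphM (absvalM hy) rmorphXn (absvalX hy) yp // Dz.
have y2x : 0 < y2 (iota x) by rewrite (absval_gt0 h2).
have a2 : y2 (iota a) = 1 by rewrite ya // divff // expf_neq0 // gt_eqF.
have a1 : y1 (iota a) != 1.
  rewrite ya //; apply: contra x12 => /eqP e; rewrite -(@eqrXn2 _ n) ?(absval_ge0 h1) ?ltW //.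
  by rewrite -[X in _ == X]mul1r -e divfK // expf_neq0 // gt_eqF.
have [c [c1 c2]] : exists c, y1 (iota c) < 1 /\ y2 (iota c) = 1.
  have [lt|le] := ltP (y1 (iota a)) 1; first by exists a.
  have gt : 1 < y1 (iota a) by rewrite lt_neqAle eq_sym a1.
  exists a^-1; rewrite fmorphV (absvalV h1) (absvalV h2) a2 invr1; split=> //.
  by rewrite invf_lt1 // (lt_trans ltr01).
have [|q [A1 A2 A3]] := unit_absval_integral_multiple p_pr h2 (b := iota c); first by rewrite c2.
pose u := (map_poly intr q).[c] : L.
have Du : iota u = (map_poly intr q).[iota c].
  by rewrite -horner_map -map_poly_comp; congr (_.[_]); apply: eq_map_poly => i /=; rewrite rmorph_int.
exists (c * u); rewrite rmorphM Du; split=> //; last by rewrite (absvalM h2) c2 A3 mulr1.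
rewrite (absvalM h1); apply: le_lt_trans c1; rewrite ler_piMr ?(absval_ge0 h1) //.
exact: (absval_Aint_le1 p_pr h1).
Qed.
End GaloisIdeals.

(** * Finiteness of places and elements supported at a single place *)

Section GaloisPlaces.
Set Implicit Arguments.
Unset Strict Implicit.
Variables (L : splittingFieldType rat) (iota : {rmorphism L -> algC}).
Hypothesis galL : galois 1 {:L}.
Variables (R : realType) (p : nat).
Hypothesis p_pr : prime p.

Local Notation OL x := (iota x \in Aint).

Lemma prime_alg_neq0 : (p%:R : L) != 0.
Proof. by rewrite -(fmorph_eq0 iota) rmorph_nat pnatr_eq0 -lt0n prime_gt0. Qed.

(* A place is determined by its maximal ideal, a union of classes modulo [p]. *)
Lemma finite_places : exists (T : finType) (C : (algC -> R) -> T),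
  forall y1 y2 : algC -> R, absval_over p y1 -> absval_over p y2 -> C y1 = C y2 ->
  forall x, y1 (iota x) = y2 (iota x).
Proof.
have [T [h hE]] := integral_residues iota galL (prime_gt0 p_pr).
(* [C y] marks the residue classes modulo [p] that meet the maximal ideal of [y]. *)
pose C (y : algC -> R) : {ffun T -> bool} :=
  [ffun c => `[< exists z, [/\ OL z, y (iota z) < 1 & h z = c] >]].
exists {ffun T -> bool}, C => y1 y2 h1 h2 C12 x; apply: contrapT => /eqP x12.
have [b [Ob b1 b2]] := separate_places p_pr h1 h2 x12.
have : C y1 (h b) by rewrite ffunE; apply/asboolP; exists b.
rewrite C12 ffunE => /asboolP[z [Oz z1 hz]].
have Oq := hE _ _ Ob Oz (esym hz).
have : y2 (iota b) < 1; last by rewrite b2 ltxx.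
have -> : b = z + p%:R * ((b - z) / p%:R).
  by rewrite mulrC divfK ?prime_alg_neq0 // addrC subrK.
rewrite rmorphD rmorphM rmorph_nat; apply: (absval_ultra_lt p_pr h2) => //.
rewrite (absvalM h2) (absval_prime p_pr h2).
apply: (@le_lt_trans _ _ p%:R^-1).
  by rewrite ler_piMr ?invr_ge0 ?ler0n // (absval_Aint_le1 p_pr h2).
by rewrite invf_lt1 ?(prime_real_gt0 R p_pr) ?(prime_real_gt1 R p_pr).
Qed.

(* Two of the ideals [I m = {v <= p^-m}] differ by a principal factor. *)
Lemma place_uniformizer_power (v : algC -> R) : absval_over p v ->
  exists a : L, [/\ a != 0, v (iota a) < 1 &
    forall (l : nat) (y : algC -> R), prime l -> absval_over l y ->
      (exists x, y (iota x) != v (iota x)) -> y (iota a) = 1].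
Proof.
move=> hv; have [M M0 hM] := ideal_division iota galL.
have [T [h hE]] := integral_residues iota galL M0.
have M0L : (M%:R : L) != 0 by rewrite -(fmorph_eq0 iota) rmorph_nat pnatr_eq0 -lt0n.
have p0 := prime_real_gt0 R p_pr; have p1 := prime_real_gt1 R p_pr.
pose I m x := OL x /\ v (iota x) <= p%:R ^- m.
have IO m x : I m x -> OL x by case.
have ID m x z : I m x -> I m z -> I m (x + z).
  move=> [Ox vx] [Oz vz]; split; first exact: OL_D.
  by rewrite rmorphD (absval_ultra p_pr hv).
have IM m x z : OL z -> I m x -> I m (z * x).
  move=> Oz [Ox vx]; split; first exact: OL_M.
  rewrite rmorphM (absvalM hv); apply: le_trans vx.
  by rewrite ler_piMl ?(absval_ge0 hv) ?(absval_Aint_le1 p_pr hv).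
have IB m x z : I m x -> I m z -> I m (x - z).
  move=> Ix Iz; apply: ID => //; rewrite -mulN1r; apply: IM => //.
  exact: (OL_int iota (-1)).
have Ip m : I m (p%:R ^+ m).
  split; first by apply: OL_X; apply: OL_nat.
  by rewrite rmorphXn rmorph_nat (absvalX hv) (absval_prime p_pr hv) exprVn.
have /choice[b hb] m : exists b, [/\ I m b, b != 0 & forall x, I m x -> OL (M%:R * x / b)].
  apply: hM; [exact: IO | exact: IB | exact: IM |].
  by exists (p%:R ^+ m); rewrite ?expf_neq0 ?prime_alg_neq0.
(* [J m] is the integral ideal [(M / b_m) I_m]. It contains [M], so it is a union of classes of [h],
   recorded by [col m]. *)
pose J m z := OL z /\ I m (b m * z / M%:R).
have J_closed m x z : OL x -> OL z -> h x = h z -> J m z -> J m x.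
  move=> Ox Oz hxz [_ Iz]; split=> //; have [Ib b0 _] := hb m.
  have -> : b m * x / M%:R = b m * z / M%:R + (x - z) / M%:R * b m.
    by field.
  by apply: ID => //; apply: IM => //; apply: hE.
pose col m : {ffun T -> bool} := [ffun c => `[< exists z, J m z /\ h z = c >]].
have colP m z : OL z -> col m (h z) <-> J m z.
  move=> Oz; rewrite ffunE; split=> [/asboolP[x [Jx hx]]|Jz].
    by apply: (J_closed _ _ x) => //; case: Jx.
  by apply/asboolP; exists z.
have [m [n [mn _ colmn]]] := pigeonhole_nat col (leqnn _).
have [Ibm bm0 hbm] := hb m; have [Ibn bn0 hbn] := hb n.
(* As [J m = J n], multiplication by [a] carries [I m] onto [I n]; [fwd] and [bwd] are the two
   inclusions. *)
pose a := b n / b m; have a0 : a != 0 by rewrite mulf_neq0 ?invr_eq0.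
have fwd x : I m x -> I n (a * x).
  move=> Ix; have Oz := hbm _ Ix.
  have : J m (M%:R * x / b m).
    by split=> //; rewrite [b _ * _]mulrC divfK // mulrAC divff // mul1r.
  move=> /(colP _ _ Oz); rewrite colmn => /(colP _ _ Oz)[_].
  suff -> : b n * (M%:R * x / b m) / M%:R = a * x by [].
  by rewrite /a; field; rewrite ?M0L ?bm0 ?bn0.
have bwd x : I n x -> I m (x / a).
  move=> Ix; have Oz := hbn _ Ix.
  have : J n (M%:R * x / b n).
    by split=> //; rewrite [b _ * _]mulrC divfK // mulrAC divff // mul1r.
  move=> /(colP _ _ Oz); rewrite -colmn => /(colP _ _ Oz)[_].
  suff -> : b m * (M%:R * x / b n) / M%:R = x / a by [].
  by rewrite /a; field; rewrite ?M0L ?bm0 ?bn0.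
exists a; split=> // [|l y l_pr hy [x x_ne]].
  (* [p^m] lies in [I m], so [v a * p^-m <= p^-n] with [m < n]. *)
  have [_] := fwd _ (Ip m); rewrite rmorphM (absvalM hv) rmorphXn rmorph_nat (absvalX hv).
  rewrite (absval_prime p_pr hv) exprVn ler_pdivrMr ?exprn_gt0 // => /le_lt_trans; apply.
  by rewrite mulrC ltr_pdivrMr ?exprn_gt0 // mul1r ltr_eXn2l.
(* Over the same prime, a power of an algebraic integer separating [v] from [y] serves; over another
   prime, [p^k] itself. *)
have unitI k : exists2 z, I k z & y (iota z) = 1.
  have [lp|lp] := eqVneq l p.
    rewrite lp in hy; rewrite eq_sym in x_ne.
    have [c [Oc c1 c2]] := separate_places p_pr hv hy x_ne.
    have c0 : iota c != 0 by rewrite -(absval_gt0 hy) c2.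
    have [e [w [e0 De]]] := absval_expr_prime p_pr hv c0.
    (* An integral power of [p] below 1 is at most [1/p]. *)
    have {w}De : v (iota c) ^+ e <= p%:R^-1.
      have : v (iota c) ^+ e < 1 by rewrite exprn_ilt1 ?(absval_ge0 hv) // -lt0n.
      rewrite De; case: w {De} => j.
        by rewrite ltNge exprn_ege1 // ltW.
      by rewrite NegzE -exprnN lef_pV2 ?posrE ?exprn_gt0 // exprS ler_peMr ?exprn_ege1 ?ltW.
    exists (c ^+ (e * k)); last by rewrite rmorphXn (absvalX hy) c2 expr1n.
    split; first exact: OL_X.
    rewrite rmorphXn (absvalX hv) exprM -exprVn lerXn2r ?nnegrE ?exprn_ge0 ?(absval_ge0 hv) //.
    by rewrite invr_ge0 ltW.
  exists (p%:R ^+ k) => //; rewrite rmorphXn rmorph_nat (absvalX hy).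
  by rewrite (absval_other_prime hy) ?expr1n // eq_sym.
have le1 z k : I k z -> y (iota z) <= 1.
  by move=> /IO Oz; apply: (absval_Aint_le1 l_pr hy).
(* A unit at [y] in [I m] gives [y a <= 1] through [fwd]; one in [I n] gives [y a >= 1] through
   [bwd]. *)
apply/eqP; rewrite eq_le; apply/andP; split.
  have [z Iz z1] := unitI m; have := le1 _ _ (fwd _ Iz).
  by rewrite rmorphM (absvalM hy) z1 mulr1.
have [z Iz z1] := unitI n; have := le1 _ _ (bwd _ Iz).
rewrite fmorph_div (absvalM hy) (absvalV hy) z1 mul1r invf_le1 //.
by rewrite (absval_gt0 hy) fmorph_eq0.
Qed.
End GaloisPlaces.

(** * Independence of the field *)

Section Places.
Set Implicit Arguments.
Unset Strict Implicit.
Variable R : realType.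
Implicit Types (K : set algC) (y v w : algC -> R).

Lemma restr_restr K L y : K `<=` L -> restr K (restr L y) = restr K y.
Proof.
move=> KL; apply/funext => x; rewrite /restr; case: asboolP => // Kx.
by case: asboolP => // nLx; case: nLx; apply: KL.
Qed.

Lemma restr_in K y x : K x -> restr K y x = y x.
Proof. by move=> Kx; rewrite /restr; case: asboolP. Qed.

Lemma eq_restr K y y' : (forall x, K x -> y x = y' x) -> restr K y = restr K y'.
Proof.
by move=> h; apply/funext => x; rewrite /restr; case: asboolP => // /h.
Qed.

Lemma restr_eq_in K y y' x : restr K y = restr K y' -> K x -> y x = y' x.
Proof. by move=> e Kx; rewrite -(restr_in y Kx) e restr_in. Qed.

Lemma number_field_nat K n : number_field K -> K n%:R.
Proof.
case=> K1 KB _ _ _; have K0 : K 0 by rewrite -(subrr 1); apply: KB.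
have KN x : K x -> K (- x) by move=> Kx; rewrite -sub0r; apply: KB.
by elim: n => [//|n IHn]; have := KB _ _ IHn (KN _ K1); rewrite opprK natr1.
Qed.

Lemma place_prime_uniq K p l y y' : number_field K -> prime p -> prime l ->
  absval_over p y -> absval_over l y' -> restr K y = restr K y' -> p = l.
Proof.
move=> nfK p_pr l_pr hy hy' yy'; apply/eqP; apply: contrapT => /negP pl.
have := restr_eq_in yy' (number_field_nat p nfK).
rewrite (absval_prime p_pr hy) (absval_other_prime hy') // => /eqP.
by rewrite lt_eqF // invf_lt1 ?(prime_real_gt0 R p_pr) // (prime_real_gt1 R p_pr).
Qed.

Lemma number_field_range (L : fieldExtType rat) (iota : {rmorphism L -> algC}) :
  number_field (range iota).
Proof.
split.
- by exists 1 => //; rewrite rmorph1.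
- by move=> _ _ [a _ <-] [b _ <-]; exists (a - b); rewrite ?rmorphB.
- by move=> _ _ [a _ <-] [b _ <-]; exists (a * b); rewrite ?rmorphM.
- by move=> _ [a _ <-]; exists a^-1; rewrite ?fmorphV.
exists (map iota (vbasis {:L})) => _ [a _ <-].
pose n : nat := \dim {:L}.
pose c : seq rat := [seq coord (vbasis {:L}) i a | i <- enum 'I_n].
exists c; set s := map _ _.
have szs : size s = n by rewrite size_map size_tuple.
rewrite -(big_mkord xpredT (fun i => ratr (nth 0 c i) * s`_i)) szs big_mkord.
rewrite {1}(coord_vbasis (memvf a)) rmorph_sum; apply: eq_bigr => i _.
rewrite rmorphZ_num /c (nth_map i) ?size_enum_ord // nth_ord_enum.
by rewrite /s (nth_map 0) // size_tuple.
Qed.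

(** Serves to compare sums over two number fields inside one Galois field, built from spanning
    families of both. *)
Lemma galois_container (K K' : set algC) : number_field K -> number_field K' ->
  exists (L : splittingFieldType rat) (iota : {rmorphism L -> algC}),
  [/\ galois 1 {:L}, K `<=` range iota & K' `<=` range iota].
Proof.
move=> [_ _ _ _ [s hs]] [_ _ _ _ [s' hs']].
have [L [iota [galL Ls]]] := galois_number_field (s ++ s').
have span (t : seq algC) (x : algC) : {subset t <= s ++ s'} ->
    (exists c : seq rat, x = \sum_(i < size t) ratr (nth 0 c i) * t`_i) ->
    range iota x.
  move=> ts [c ->]; have /choice[a ha] (i : 'I_(size t)) : exists a, iota a = t`_i.
    by apply/Ls/ts; rewrite mem_nth.
  exists (\sum_(i < size t) nth 0 c i *: a i) => //; rewrite rmorph_sum; apply: eq_bigr => i _.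
  by rewrite rmorphZ_num ha.
exists L, iota; split=> // x => [/hs|/hs'] h; apply: span h => z zs.
  by rewrite mem_cat zs.
by rewrite mem_cat zs orbT.
Qed.

Section GaloisFiber.
Variables (L : splittingFieldType rat) (iota : {rmorphism L -> algC}).
Hypothesis galL : galois 1 {:L}.

Lemma finite_places_over p : prime p -> finite_set [set w | place_of (R := R) (range iota) p w].
Proof.
move=> p_pr; have [T [C hC]] := finite_places iota galL R p_pr.
(* [g] picks one place for each value of the finite invariant [C]. *)
pose g (t : T) := xget 0 [set w | exists y, [/\ absval_over p y, C y = t & w = restr (range iota) y]].
apply: (@sub_finite_set _ _ (g @` [set: T])); last exact/finite_image/finite_finset.
move=> _ [y [hy ->]]; exists (C y) => //; rewrite /g.
case: xgetP => [w Dw [y' [hy' Cy' ->]]|/(_ (restr (range iota) y)) []]; last by exists y.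
by apply: eq_restr => _ [a _ <-]; apply: hC.
Qed.

Lemma finite_fiber (S : set nat) K v : (forall p, S p -> prime p) ->
  number_field K -> K `<=` range iota -> MK S K v ->
  finite_set [set w | MK S (range iota) w /\ restr K w = v].
Proof.
move=> S_pr nfK KL [p Sp [y [hy ->]]].
apply: sub_finite_set (finite_places_over (S_pr _ Sp)).
move=> _ [[l Sl [y' [hy' ->]]]]; rewrite restr_restr // => e.
by exists y'; rewrite (place_prime_uniq nfK (S_pr _ Sp) (S_pr _ Sl) hy hy' (esym e)).
Qed.
End GaloisFiber.

Lemma fval_adapted (S : set nat) (f : (algC -> R) -> R) K y : adapted S f K -> Xset S y ->
  fval S f K (restr K y) = f y.
Proof.
move=> [_ fK _] Xy; rewrite /fval.
case: xgetP => [r -> [y' [Yy' <-]]|/(_ (f y))[]]; last by exists y.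
apply: fK Yy' _ => //; case: Xy => p Sp hy; exists p => //; by exists y.
Qed.

(** Group the places of the larger field by their restriction [v]: [f] is constant on each fibre,
    and the fibre sum of [c] is [c K v] by consistency. *)
Lemma Phi_sum_extend (S : set nat) c (f : (algC -> R) -> R) K
    (L : splittingFieldType rat) (iota : {rmorphism L -> algC}) :
  (forall p, S p -> prime p) -> galois 1 {:L} -> consistent S c ->
  adapted S f K -> K `<=` range iota ->
  \sum_(v \in MK S K) c K v * fval S f K v =
  \sum_(w \in MK S (range iota)) c (range iota) w * fval S f (range iota) w.
Proof.
move=> S_pr galL cc fK KL; have [nfK cst finA] := fK.
set M := range iota; have nfM : number_field M := number_field_range iota.
have MK_restr w : MK S M w -> MK S K (restr K w).
  move=> [p Sp [y [hy ->]]]; exists p => //; exists y.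
  by rewrite restr_restr.
have fvalE w : MK S M w -> fval S f M w = fval S f K (restr K w).
  move=> [p Sp [y [hy ->]]]; have Xy : Xset S y by exists p.
  rewrite restr_restr // (fval_adapted fK) // /fval.
  case: xgetP => [r -> [y' [[Xy' e] <-]]|/(_ (f y))[]]; last by exists y.
  have KM : K `<=` M := KL.
  have e' : restr K y' = restr K y by rewrite -(restr_restr _ KM) e restr_restr.
  by rewrite -!(fval_adapted fK) // e'.
set A := [set v | MK S K v /\ fval S f K v != 0] in finA.
pose fib v := [set w | MK S M w /\ restr K w = v].
(* Exchanging the sums needs finite index sets: [A] is finite because [f] is adapted, [B] because
   fibres are finite. *)
pose B := [set w | MK S M w /\ A (restr K w)].
have finB : finite_set B.
  apply: (@sub_finite_set _ _ (\bigcup_(v in A) fib v)).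
    by move=> w [Mw Aw]; exists (restr K w).
  by apply: bigcup_finite => // v [Kv _]; apply: finite_fiber.
transitivity (\sum_(v \in A) c K v * fval S f K v).
  apply/esym/fsbig_widen => [v [] //|v [Kv nA] /=].
  have [->|n0] := eqVneq (fval S f K v) 0; first by rewrite mulr0.
  by case: nA.
transitivity (\sum_(w \in B) c M w * fval S f M w); last first.
  apply: fsbig_widen => [w [] //|w [Mw nB] /=].
  rewrite fvalE //; have [->|n0] := eqVneq (fval S f K (restr K w)) 0; first by rewrite mulr0.
  by case: nB; split=> //; split=> //; apply: MK_restr.
pose F v w := if `[< restr K w = v >] then c M w * fval S f K v else 0.
transitivity (\sum_(v \in A) \sum_(w \in B) F v w).
  apply: eq_fsbigr => v /set_mem Av; have [Kv _] := Av.
  rewrite (cc _ _ _ nfK Kv nfM KL) mulr_fsuml.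
  transitivity (\sum_(w \in fib v) F v w).
    by apply: eq_fsbigr => w /set_mem[_ e]; rewrite /F asboolT.
  apply: fsbig_widen => [w [Mw e]|w [[Mw _] nf] /=]; first by split=> //; rewrite e.
  by rewrite /F asboolF // => e; apply: nf.
rewrite exchange_fsbig //; apply: eq_fsbigr => w /set_mem[Mw Aw].
rewrite -(@fsbig_widen _ _ _ _ [set restr K w]).
- by rewrite fsbig_set1 /F asboolT // fvalE.
- by move=> v ->.
- by move=> v [_ nv]; rewrite /= /F asboolF // => e; apply: nv.
Qed.

(** A sum of infinite support is 0 by convention, hence rational; otherwise it is a finite sum of
    rationals. *)
Lemma is_rat_fsum (I : choiceType) (P : set I) (F : I -> R) :
  (forall i, P i -> is_rat (F i)) -> is_rat (\sum_(i \in P) F i).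
Proof.
move=> PF; have rat0 : is_rat (0 : R) by exists 0; rewrite rmorph0.
case: finite_supportP; rewrite ?big_nil// => X XP F0 _.
rewrite big_seq_cond; elim/big_ind: _ => // [_ _ [a ->] [b ->]|i /andP[/XP Pi _]].
  by exists (a + b); rewrite rmorphD.
exact: PF.
Qed.

Lemma is_ratM (a b : R) : is_rat a -> is_rat b -> is_rat (a * b).
Proof. by move=> [q ->] [r ->]; exists (q * r); rewrite rmorphM. Qed.

End Places.

(** * Rationality of [Phi_c] on logarithms against rationality of [c(K, v) log p] *)

Theorem theorem4p2 (R : realType) (S : set nat)
  (c : set algC -> (algC -> R) -> R) :
  (forall p, S p -> prime p) ->
  consistent S c ->
  ([set Phi S c (flog a) | a in [set a : algC | a != 0]] `<=` [set x | is_rat x]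
   <->
   (forall K v p, number_field K -> S p -> place_of K p v ->
      is_rat (c K v * ln (p%:R : R)))).
Proof.
move=> S_pr cc; split=> [PhiQ K v p nfK Sp [y [hy Dv]]|cQ _ [a /= a0 <-]]; last first.
  (* If no field were adapted, [Phi] would take its default value 0, which is rational. *)
  rewrite /Phi; case: xgetP => [r -> [K [[nfK _ _] ->]]|_]; last by exists 0; rewrite rmorph0.
  apply: is_rat_fsum => v Kv; rewrite /fval.
  case: xgetP => [t -> [y [[[p Sp hy] Dv] <-]]|_]; last by exists 0; rewrite mulr0 rmorph0.
  have [q Dq] := ln_absval (S_pr _ Sp) hy a0.
  rewrite /flog Dq mulrCA; apply: is_ratM; first by exists q.
  by apply: cQ => //; exists y.
have p_pr := S_pr _ Sp; have Kv : MK S K v by exists p => //; exists y.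
have [L [iota [galL KL _]]] := galois_container nfK nfK.
have nfL := number_field_range iota; set M := range iota in nfL KL *.
(* Consistency distributes [c K v] over the places [w] above [v] in the Galois field, so each [w]
   can be treated alone. *)
rewrite (cc _ _ _ nfK Kv nfL KL) mulr_fsuml; apply: is_rat_fsum => w [[l Sl [y' [hy' Dw]]] wv].
have {l Sl hy'} hy' : absval_over p y'.
  suff -> : p = l by [].
  apply: (place_prime_uniq nfK p_pr (S_pr _ Sl) hy hy').
  by rewrite -Dv -wv Dw restr_restr.
have [a [a0 ya1 ya]] := place_uniformizer_power iota galL p_pr hy'.
have b0 : iota a != 0 by rewrite fmorph_eq0.
have Ma : M (iota a) by exists a.
pose f := flog (iota a) : (algC -> R) -> R.
have fres y1 y2 : restr M y1 = restr M y2 -> f y1 = f y2.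
  by move=> e; rewrite /f /flog (restr_eq_in e Ma).
have Mw : MK S M w by exists p => //; exists y'.
have fvw : fval S f M w = f y'.
  rewrite /fval; case: xgetP => [r -> [y1 [[_ e] <-]]|/(_ (f y'))[]].
    by apply: fres; rewrite e.
  by exists y'; split=> //; split=> //; exists p.
have fv0 u : MK S M u -> u <> w -> fval S f M u = 0.
  move=> Mu uw; rewrite /fval; case: xgetP => [r -> [y1 [[[l Sl hy1] e] <-]]|//].
  rewrite /f /flog (ya l y1 (S_pr _ Sl) hy1) ?ln1 //; apply: contrapT => no; apply: uw.
  rewrite -e Dw; apply: eq_restr => _ [x _ <-].
  by apply: contrapT => /eqP ?; apply: no; exists x.
have fM : adapted S f M.
  split=> // [u _ y1 y2 [_ e1] [_ e2]|]; first by apply: fres; rewrite e1.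
  apply: (@sub_finite_set _ _ [set w]); last exact: finite_set1.
  by move=> u [Mu fu] /=; apply: contrapT => uw; rewrite fv0 ?eqxx in fu.
(* [f] vanishes at every place of [M] except [w], which leaves a single term. *)
have sumM : \sum_(u \in MK S M) c M u * fval S f M u = c M w * f y'.
  rewrite -(@fsbig_widen _ _ _ _ [set w]) ?fsbig_set1 ?fvw //; first by move=> u ->.
  by move=> u [Mu uw] /=; rewrite fv0 ?mulr0.
have PhiE : Phi S c f = c M w * f y'.
  (* [xget] selects an unknown adapted field [K']; its sum and the one over [M] both equal the sum
     over a Galois field containing the two. *)
  rewrite /Phi; case: xgetP => [r -> [K' [fK' ->]]|/(_ (c M w * f y'))[]]; last first.
    by exists M; rewrite sumM.
  have [nfK' _ _] := fK'.
  have [L' [iota' [galL' K'L' ML']]] := galois_container nfK' nfL.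
  by rewrite (Phi_sum_extend S_pr galL' cc fK' K'L') -(Phi_sum_extend S_pr galL' cc fM ML').
have : is_rat (Phi S c f) by apply: PhiQ; exists (iota a).
rewrite PhiE /f /flog; have [q Dq] := ln_absval p_pr hy' b0; rewrite Dq.
(* [y' (iota a) < 1] makes the logarithm nonzero, so [q] can be divided out. *)
have q0 : q != 0.
  apply/eqP => q0; move: Dq; rewrite q0 rmorph0 mul0r => /eqP.
  by rewrite ln_eq0 ?(absval_gt0 hy') // lt_eqF.
move=> rQ; have -> : c M w * ln p%:R = ratr q^-1 * (c M w * (ratr q * ln p%:R)).
  by rewrite [RHS]mulrCA [ratr q^-1 * _]mulrA -rmorphM mulVf // rmorph1 mul1r.
by apply: is_ratM => //; exists q^-1.
Qed.
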